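(* Let $0<\alpha<1$, let $I\subset\mathbb{R}$ be an interval, $t_0\in I$, let $A$ be an $n\times n$ matrix function continuous on $I$, and let $\tilde{x}_0\in\mathbb{R}^n$. Assume that the generalized Peano--Baker series $\tilde{\Phi}(t,t_0)=\sum_{k=0}^{\infty}{}_{t_0}\tilde{J}_t^{k\circ\alpha}A(t)$ converges uniformly in $t\in I$, $t\ge t_0$. Then a solution to the initial value problem $${}_{t_0}D_t^{(\alpha)}x(t)=A(t)x(t),\quad t\in\mathring{I},\ t>t_0,\qquad x(t_0)=\tilde{x}_0,$$ is given by $$x(t)=\tilde{\Phi}(t,t_0)\tilde{x}_0 .$$
   Context: $\mathring{I}$ is the interior of $I$; throughout $t_0,t\in I$, $t>t_0$. The Riemann--Liouville fractional integral of order $\beta>0$ and the Caputo (regularized) derivative of order $\alpha\in(0,1)$ are $${}_{t_0}J_t^{\beta}f(t)=\frac{1}{\Gamma(\beta)}\int_{t_0}^t(t-\tau)^{\beta-1}f(\tau)\,d\tau,\qquad {}_{t_0}D_t^{(\alpha)}f(t)={}_{t_0}J_t^{1-\alpha}\frac{d}{dt}f(t),$$ applied entrywise to vector and matrix functions. State-transition matrix (Caputo case): $\tilde{\Phi}(t,t_0)=\sum_{k=0}^{\infty}{}_{t_0}\tilde{J}_t^{k\circ\alpha}A(t)$, where, with $\mathrm{Id}$ the $n\times n$ identity matrix, $${}_{t_0}\tilde{J}_t^{0\circ\alpha}A(t)=\mathrm{Id},\qquad {}_{t_0}\tilde{J}_t^{(k+1)\circ\alpha}A(t)={}_{t_0}J_t^{\alpha}\bigl(A(t)\,{}_{t_0}\tilde{J}_t^{k\circ\alpha}A(t)\bigr),\quad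 k=0,1,\ldots$$
   Formalization: For merely continuous A the solution x may be nowhere differentiable, so the Caputo derivative is read as d/dt of J^{1-α}(x − x(t_0)); the literal J^{1-α}(dx/dt) = A x is asserted at each t where x is absolutely continuous on [t_0,t] and that integral converges. *)

(* Defs.v *)
From mathcomp Require Import all_boot all_order all_algebra.
From mathcomp Require Import all_classical all_reals all_analysis.

Set Implicit Arguments.
Unset Strict Implicit.
Unset Printing Implicit Defensive.

Import Order.TTheory GRing.Theory Num.Theory.
Import numFieldNormedType.Exports.

Local Open Scope classical_set_scope.
Local Open Scope ring_scope.

Definition Gamma (R : realType) (b : R) : R :=
  \int[lebesgue_measure]_(s in `]0%R, +oo[) (s `^ (b - 1) * expR (- s)).

Definition RL_kernel (R : realType) (b : R) (f : R -> R) (t s : R) : R :=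
  (t - s) `^ (b - 1) * f s.

Definition RL_integrable (R : realType) (b t0 : R) (f : R -> R) (t : R) : Prop :=
  lebesgue_measure.-integrable `[t0, t] (EFin \o RL_kernel b f t).

Definition RL_integral (R : realType) (b t0 : R) (f : R -> R) (t : R) : R :=
  (Gamma b)^-1 * \int[lebesgue_measure]_(s in `[t0, t]) RL_kernel b f t s.

Definition RL_integral_mx (R : realType) (m n : nat) (b t0 : R)
    (F : R -> 'M[R]_(m, n)) (t : R) : 'M[R]_(m, n) :=
  \matrix_(i, j) RL_integral b t0 (fun s => F s i j) t.

Fixpoint PB_term (R : realType) (n : nat) (a : R) (A : R -> 'M[R]_n) (t0 : R)
    (k : nat) : R -> 'M[R]_n :=
  if k is k'.+1 then RL_integral_mx a t0 (fun s => A s *m PB_term a A t0 k' s)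
  else fun=> 1%:M.

Definition PB_partial_sum (R : realType) (n : nat) (a : R) (A : R -> 'M[R]_n)
    (t0 : R) (N : nat) (t : R) : 'M[R]_n :=
  series (fun k => PB_term a A t0 k t) N.

Definition state_transition (R : realType) (n : nat) (a : R)
    (A : R -> 'M[R]_n) (t t0 : R) : 'M[R]_n :=
  limn (fun N => PB_partial_sum a A t0 N t).

(* The derivative d/dt f in J^(1-a) (d/dt f), as an integrable function: f is
   absolutely continuous on [t0, t], i.e. it is the integral of its almost
   everywhere derivative.  Every f that is continuous on [t0, t], differentiable
   on ]t0, t[ and has an integrable derivative there satisfies this. *)
Definition abs_continuous (R : realType) (t0 t : R) (f : R -> R) : Prop :=
  lebesgue_measure.-integrable `[t0, t] (EFin \o derive1 f) /\
  forall s, s \in `[t0, t] ->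
    f s = f t0 + \int[lebesgue_measure]_(r in `[t0, s]) derive1 f r.

(* [is_Caputo a t0 f t v] : the Caputo (regularized) derivative of order a at t
   of f equals v.  The defining expression J^(1-a) (d/dt f) (t) has no meaning
   for a general f of the form c + J^a g with g continuous: such an f may be
   nowhere differentiable (take g Hoelder, of small exponent, of Weierstrass
   type).  For absolutely continuous f,
     J^(1-a) (d/dt f) = d/dt J^(1-a) (f - f t0)   almost everywhere,
   and the right-hand side is the meaning given to the derivative in general
   (first two clauses).  The last clause requires in addition that v be the
   value of J^(1-a) (d/dt f) (t) itself as soon as that expression is defined
   at t. *)
Definition is_Caputo (R : realType) (a t0 : R) (f : R -> R) (t v : R) : Prop :=
  [/\ \forall s \near t, RL_integrable (1 - a) t0 (fun r => f r - f t0) s,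
      is_derive t 1 (RL_integral (1 - a) t0 (fun r => f r - f t0)) v
    & abs_continuous t0 t f -> RL_integrable (1 - a) t0 (derive1 f) t ->
      RL_integral (1 - a) t0 (derive1 f) t = v].

Definition is_Caputo_cV (R : realType) (n : nat) (a t0 : R)
    (x : R -> 'cV[R]_n) (t : R) (v : 'cV[R]_n) : Prop :=
  forall i, is_Caputo a t0 (fun s => x s i 0) t (v i 0).

(* Main.v *)
Require Import Defs.
From mathcomp Require Import all_boot all_order all_algebra.
From mathcomp Require Import all_classical all_reals all_analysis.
From mathcomp Require Import measurable_realfun ring lra.

Set Implicit Arguments.
Unset Strict Implicit.
Unset Printing Implicit Defensive.

Import Order.TTheory GRing.Theory Num.Theory.
Import numFieldNormedType.Exports.

Local Open Scope classical_set_scope.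
Local Open Scope ring_scope.

(** The transition matrix is the uniform limit of partial sums that satisfy
    [S_(N+1) = Id + J^a (A S_N)] (lemma [PB_partial_sum_rec]).  On a compact
    interval [J^a] is bounded for the uniform norm ([RL_integral_bound]), so the
    limit satisfies [Phi = Id + J^a (A Phi)] ([Phi_volterra]) and
    [x = Phi x0] solves the Volterra equation [x = x0 + J^a (A x)].

    What remains is a statement about one coordinate, [is_Caputo_volterra]:  if
    [f = f t0 + J^a g] on some [[t0, T]] with t < T, where g is bounded, measurable
    and continuous at t, then g t is the Caputo derivative of f at t.  Its core is Abel's identity
    [J^(1-a) J^a g = J^1 g] ([kint_abel]):  it turns [J^(1-a) (f - f t0)] into the
    primitive of g, whose derivative at t is g t by the fundamental theorem of
    calculus.  By Fubini ([kint_comp]) Abel's identity reduces to the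
    convolution of two power kernels ([kern_convolution]), which is constant and
    equal to the Beta integral B(1-a, a), and to Euler's relation
    [Gamma (1-a) * Gamma a = B(1-a, a)] ([Gamma_Beta]).  The continuity of x,
    needed for that of g, comes from the Hoelder estimate [kint_hoelder].

    When f is moreover the primitive of an integrable h, composing [J^(1-a)] with
    [f - f t0 = J^1 h] shows that [J^(1-a) h] and g have the same primitive, hence
    agree almost everywhere.  The value at t itself is wanted, and there
    [kint_endpoint] compares left difference quotients:  those of
    [J^(2-a) h = J^1 (J^(1-a) h)] converge to [J^(1-a) h] at t by dominated
    convergence, since the quotients of the kernel u^(1-a) are at most u^(-a).

    All integrals are written as convolutions over the whole line with the kernel
    [kern b], extended by 0 to the negative half-line, applied to functions that
    vanish to the left of t0; the domain [[t0, t]] is then the intersection of the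
    two supports, and Fubini and the changes of variables need no bounds. *)

(** * Affine changes of variables *)

Section affine.
Context {R : realType}.
Local Notation mu := (@lebesgue_measure R).
Local Open Scope ereal_scope.

Let aff (c d : R) (x : measurableTypeR R) : measurableTypeR R := (c * x + d)%R.

Let measurable_aff c d : measurable_fun [set: measurableTypeR R] (aff c d).
Proof. by apply: measurable_funD => //; apply: measurable_funM. Qed.

Lemma lebesgue_measure_affine (c d : R) (c0 : (0 < c)%R) (A : set R) :
  measurable A -> mu A = c%:E * mu ((fun x => c * x + d)%R @^-1` A).
Proof.
move=> mA.
rewrite (@lebesgue_measure_unique _
  (mscale (NngNum (ltW c0)) (pushforward mu (aff c d)))) //=.
move=> X [[a b]] _ <-; rewrite /mscale/= /pushforward.
have -> : aff c d @^-1` `]a, b] = `]((a - d) / c)%R, ((b - d) / c)%R]%classic.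
  apply/seteqP; split=> x /=; rewrite !in_itv/= /aff ltr_pdivrMr// ler_pdivlMr//;
  by rewrite ltrBlDr lerBrDr mulrC.
rewrite !lebesgue_measure_itv/= !lte_fin ltr_pM2r ?invr_gt0// ltrD2r.
case: ifPn => ab; last by rewrite mule0.
rewrite -!EFinB -EFinM; congr EFin; field; exact: lt0r_neq0.
Qed.

Lemma ge0_integral_affine (c d : R) (f : R -> \bar R) : (0 < c)%R ->
  measurable_fun setT f -> (forall x, 0 <= f x) ->
  \int[mu]_x f x = c%:E * \int[mu]_x f (c * x + d)%R.
Proof.
move=> c0 mf f0.
have := @ge0_integral_mscale _ _ _ (pushforward mu (aff c d)) setT measurableT
  (NngNum (ltW c0)) f mf (fun x _ => f0 x).
move=> /(_ (measurable_aff c d)).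
rewrite ge0_integral_pushforward//= preimage_setT => <-.
apply: eq_measure_integral => A mA _.
exact: lebesgue_measure_affine.
Qed.

Lemma ge0_integral_shift (d : R) (f : R -> \bar R) :
  measurable_fun setT f -> (forall x, 0 <= f x) ->
  \int[mu]_x f (x - d)%R = \int[mu]_x f x.
Proof.
move=> mf f0; rewrite [RHS](@ge0_integral_affine 1 (- d))// mul1e.
by apply: eq_integral => x _; rewrite mul1r.
Qed.

Lemma ge0_integral_opp (f : R -> \bar R) :
  measurable_fun setT f -> (forall x, 0 <= f x) ->
  \int[mu]_x f (- x)%R = \int[mu]_x f x.
Proof.
move=> mf f0.
rewrite [RHS](eq_measure_integral
  (pushforward mu (-%R : _ -> measurableTypeR R))) /=; last first.
  by move=> A mA _; rewrite lebesgue_measureN.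
by rewrite ge0_integral_pushforward//= preimage_setT.
Qed.

Lemma ge0_integral_reflect (t : R) (f : R -> \bar R) :
  measurable_fun setT f -> (forall x, 0 <= f x) ->
  \int[mu]_x f (t - x)%R = \int[mu]_x f x.
Proof.
move=> mf f0.
rewrite -[RHS]ge0_integral_opp// -[RHS](ge0_integral_shift t).
- by apply: eq_integral => x _; rewrite opprB.
- exact: measurableT_comp.
- by [].
Qed.

End affine.

(** * Power kernels and Euler's Beta integral *)

Section kernel.
Context {R : realType}.
Local Notation mu := (@lebesgue_measure R).
Implicit Types (a b s t u w : R).

(** The unnormalised kernel of the Riemann--Liouville integral of order b.  The
    point 0 is kept in the support so that [kern 1] is the indicator of the
    closed half-line; for b other than 1 the value there is 0 anyway. *)
Definition kern (b u : R) : R := if 0 <= u then u `^ (b - 1) else 0.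

Lemma kern_ge0 b u : 0 <= kern b u.
Proof. by rewrite /kern; case: ifP => // _; exact: powR_ge0. Qed.

Lemma kern_lt0 b u : u < 0 -> kern b u = 0.
Proof. by move=> u0; rewrite /kern leNgt u0. Qed.

Lemma kern_le0 b u : b != 1 -> u <= 0 -> kern b u = 0.
Proof.
move=> b1; rewrite le_eqVlt => /orP[/eqP ->|/kern_lt0 //].
by rewrite /kern lexx powR0// subr_eq0.
Qed.

Lemma kern_gt0E b u : 0 < u -> kern b u = u `^ (b - 1).
Proof. by move=> /ltW u0; rewrite /kern u0. Qed.

Lemma kern1 (u : R) : 0 <= u -> kern 1 u = 1.
Proof. by move=> u0; rewrite /kern u0 subrr powRr0. Qed.

Lemma measurable_kern b : measurable_fun [set: R] (kern b).
Proof.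
by apply: measurable_fun_ifT => //; exact: measurable_fun_ler.
Qed.

Lemma measurable_kernl b (t : R) : measurable_fun [set: R] (fun s => kern b (t - s)).
Proof.
by apply: measurableT_comp; [exact: measurable_kern|exact: measurable_funB].
Qed.

Lemma measurable_kernr b (t : R) : measurable_fun [set: R] (fun s => kern b (s - t)).
Proof.
by apply: measurableT_comp; [exact: measurable_kern|exact: measurable_funB].
Qed.

Lemma kernM b w s : 0 < w -> kern b (w * s) = w `^ (b - 1) * kern b s.
Proof.
move=> w0; rewrite /kern pmulr_rge0//; case: ifP => s0; last by rewrite mulr0.
by rewrite powRM// ltW.
Qed.

Definition Beta (a b : R) : \bar R := (\int[mu]_s (kern a s * kern b (1 - s))%:E)%E.

Lemma measurable_kern2 a b w :
  measurable_fun [set: R] (fun s => (kern a s * kern b (w - s))%:E).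
Proof.
apply/measurable_EFinP/measurable_funM; first exact: measurable_kern.
exact: measurable_kernl.
Qed.

Lemma ae_eq_off_point (p : R) (f g : R -> \bar R) :
  (forall x, x != p -> f x = g x) -> ae_eq mu setT f g.
Proof.
move=> fg; exists [set p]; split; [exact: measurable_set1|exact: lebesgue_measure_set1|].
by move=> x /= nfg; apply: contra_notP nfg => /eqP /fg.
Qed.

(** Scaling by w maps the convolution at w to the one at 1, which is the Beta
    integral.  Only w = 0 with a + b = 1 must be left out: there the kernel of
    order 1 equals 1, while the convolution is an integral over a point. *)
Lemma kern_convolution0 a b w : (w != 0) || (a + b != 1) ->
  (\int[mu]_s (kern a s * kern b (w - s))%:E = Beta a b * (kern (a + b) w)%:E)%E.
Proof.
have [->/= ab|+ _] := eqVneq w 0.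
  rewrite (kern_le0 ab (lexx 0)) mule0 -(@integral0 _ (measurableTypeR R) R mu setT).
  apply: ae_eq_integral => //; first exact: measurable_kern2.
  apply: (@ae_eq_off_point 0) => s; rewrite neq_lt sub0r => /orP[s0|s0].
    by rewrite kern_lt0// mul0r.
  by rewrite (@kern_lt0 b) ?mulr0// oppr_lt0.
rewrite neq_lt => /orP[w0|w0].
  rewrite (kern_lt0 _ w0) mule0 integral0_eq// => s _.
  case: (ltP s 0) => s0; first by rewrite kern_lt0// mul0r.
  by rewrite (@kern_lt0 b) ?mulr0// (le_lt_trans _ w0)// gerBl.
rewrite (@ge0_integral_affine R w 0)//; last 2 first.
- exact: measurable_kern2.
- by move=> x; rewrite lee_fin mulr_ge0// kern_ge0.
transitivity (w%:E * \int[mu]_s ((w `^ (a - 1) * w `^ (b - 1))%:E *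
  (kern a s * kern b (1 - s))%:E))%E.
  congr (_ * _)%E; apply: eq_integral => s _.
  by rewrite addr0 -{2}[w]mulr1 -mulrBr !kernM// -EFinM mulrACA.
rewrite ge0_integralZl//; last 3 first.
- exact: measurable_kern2.
- by move=> x; rewrite lee_fin mulr_ge0// kern_ge0.
- by rewrite lee_fin mulr_ge0// powR_ge0.
rewrite -/(Beta a b) muleA -EFinM muleC; congr (_ * _%:E)%E.
rewrite kern_gt0E// -powRD; last by rewrite (gt_eqF w0) implybT.
rewrite -[X in X * _](powRr1 (ltW w0)) -powRD; last by rewrite (gt_eqF w0) implybT.
congr (_ `^ _); ring.
Qed.

(** The form in which the identity enters Fubini's theorem: the inner integral
    over the middle variable of two nested fractional integrals. *)
Lemma kern_convolution a b (t tau : R) : (t != tau) || (a + b != 1) ->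
  (\int[mu]_s (kern a (t - s) * kern b (s - tau))%:E =
   Beta a b * (kern (a + b) (t - tau))%:E)%E.
Proof.
move=> ttau; transitivity (\int[mu]_s (kern a s * kern b (t - tau - s))%:E)%E; last first.
  by apply: kern_convolution0; rewrite subr_eq0.
rewrite -[RHS](ge0_integral_reflect t); last 2 first.
- exact: measurable_kern2.
- by move=> x; rewrite lee_fin mulr_ge0// kern_ge0.
by apply: eq_integral => s _; rewrite opprB [t - tau + _]addrC addrA subrK.
Qed.

Lemma Beta_sym a b : Beta a b = Beta b a.
Proof.
rewrite /Beta -[LHS](ge0_integral_reflect 1); last 2 first.
- exact: measurable_kern2.
- by move=> x; rewrite lee_fin mulr_ge0// kern_ge0.
by apply: eq_integral => s _; rewrite mulrC subKr.
Qed.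

Lemma Beta_ge0 a b : (0 <= Beta a b)%E.
Proof. by apply: integral_ge0 => x _; rewrite lee_fin mulr_ge0// kern_ge0. Qed.

Lemma BetaE1 b : Beta b 1 = (\int[mu]_(s in `]0%R, 1%R]) (s `^ (b - 1))%:E)%E.
Proof.
transitivity (\int[mu]_(s in `[0%R, 1%R]) (s `^ (b - 1))%:E)%E.
  rewrite [RHS]integral_mkcond; apply: eq_integral => s _.
  rewrite patchE mem_setE in_itv/= /kern subr_ge0.
  case: (0 <= s) => /=; last by rewrite mul0r.
  by case: (s <= 1); rewrite ?mulr0// subrr powRr0 mulr1.
apply/esym/integral_itv_obnd_cbnd; apply/measurable_EFinP/measurable_funTS.
exact: measurable_powR.
Qed.

Lemma continuous_powR (p x : R) : 0 < x -> {for x, continuous (fun s : R => s `^ p)}.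
Proof.
move=> x0; apply: differentiable_continuous; apply/derivable1_diffP.
by apply: derivable_powR; rewrite in_itv/= x0.
Qed.

(** The integrand is singular at 0, so the fundamental theorem of calculus is
    applied on the intervals [[1/(i+2), 1]], which exhaust the half-open unit
    interval. *)
Lemma Beta_1 b : 0 < b -> Beta b 1 = (b^-1)%:E.
Proof.
move=> b0; rewrite BetaE1.
pose F (i : nat) := `[(i.+2%:R : R)^-1, 1]%classic.
have i1 i : (i.+2%:R : R)^-1 < 1 by rewrite invf_lt1// ltr1n.
have FU : \bigcup_i F i = `]0, 1]%classic.
  apply/seteqP; split => x; rewrite /F/=.
    by move=> [i _] /=; rewrite !in_itv/= => /andP[ix ->]; rewrite (lt_le_trans _ ix).
  rewrite in_itv/= => /andP[x0 x1]; exists (Num.truncn x^-1) => //=.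
  rewrite in_itv/= x1 andbT invf_ple ?posrE//.
  rewrite (le_trans (ltW (truncnS_gt _)))// ler_nat//.
have mf (A : set R) : measurable_fun A (fun s : R => (s `^ (b - 1))%:E).
  by apply/measurable_EFinP/measurable_funTS; exact: measurable_powR.
have := @ge0_nondecreasing_set_cvg_integral _ (measurableTypeR R) R F
   (fun s : R => (s `^ (b - 1))%:E) mu.
rewrite FU => cvgF; apply/esym.
apply: (cvg_unique _ _ (cvgF _ _ _ _)) => //; last 4 first.
- move=> m n mn; apply/subsetPset/subset_itvr.
  by rewrite bnd_simp lef_pV2 ?posrE// ler_nat !ltnS.
- by move=> i; exact: measurable_itv.
- by move=> i; exact: mf.
- by move=> i x _; rewrite lee_fin powR_ge0.
have FE i : (\int[mu]_(x in F i) (x `^ (b - 1))%:E =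
    (b^-1 * (1 - (i.+2%:R^-1) `^ b))%:E)%E.
  have pos (x : R) : i.+2%:R^-1 <= x -> 0 < x by apply: lt_le_trans.
  have cG (x : R) : 0 < x -> {for x, continuous (fun x => b^-1 * x `^ b)}.
    by move=> x0; apply: cvgMl_tmp; exact: continuous_powR.
  rewrite (@continuous_FTC2 _ _ (fun x => b^-1 * x `^ b))//.
  - by rewrite powR1 mulrBr.
  - apply: continuous_in_subspaceT => x; rewrite inE/= in_itv/= => /andP[/pos x0 _].
    exact: continuous_powR.
  - split.
    + move=> x; rewrite in_itv/= => /andP[/ltW/pos x0 _].
      by apply: derivableM => //; apply: derivable_powR; rewrite in_itv/= x0.
    + by apply: cvg_at_right_filter; apply: cG; exact: pos.
    + by apply: cvg_at_left_filter; apply: cG.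
  - move=> x; rewrite in_itv/= => /andP[/ltW/pos x0 _].
    rewrite derive1E deriveZ/=; last by apply: derivable_powR; rewrite in_itv/= x0.
    rewrite (@derive_val _ _ _ _ _ _ _ (is_derive1_powR b x0)).
    by rewrite /GRing.scale/= mulKf ?gt_eqF.
have lim : (fun i => (b^-1 * (1 - i.+2%:R^-1 `^ b))%:E) @ \oo --> (b^-1)%:E.
  apply: cvg_EFin; first by near=> n.
  rewrite -[X in _ --> X]mulr1; apply: cvgMl_tmp.
  rewrite -[X in _ --> X]subr0; apply: cvgB; first exact: cvg_cst.
  have /cvg_at_rightP := powR_cvg0 b0.
  move=> /(_ (fun i => i.+2%:R^-1)); apply; split=> //.
  have := @cvg_harmonic R; rewrite -(cvg_shiftS (@harmonic R)).
  by [].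
by rewrite -(funext FE) in lim.
Unshelve. all: by end_near. Qed.

(** Of s and 1 - s one is at least 1/2, where the decreasing kernel is at most
    its value at 1/2; this separates the two singularities. *)
Lemma Beta_fin a b : 0 < a -> a <= 1 -> 0 < b -> b <= 1 -> (Beta a b < +oo)%E.
Proof.
move=> a0 a1 b0 b1.
pose C (c : R) : R := 2^-1 `^ (c - 1).
have hC c (s : R) : c <= 1 -> 2^-1 <= s -> kern c s <= C c.
  move=> c1 s2; have s0 : 0 < s by rewrite (lt_le_trans _ s2).
  rewrite kern_gt0E// /C -[c - 1]opprB !powRN lef_pV2 ?posrE ?powR_gt0//.
  by apply: ge0_ler_powR; rewrite ?nnegrE ?subr_ge0 ?invr_ge0// ltW.
have C0 c : 0 <= C c by exact: powR_ge0.
apply: (@le_lt_trans _ _ ((C a)%:E * Beta 1 b + (C b)%:E * Beta a 1)%E).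
  have mC c d e : measurable_fun [set: R] (fun s => (C c)%:E * (kern d s * kern e (1 - s))%:E)%E.
    by apply: emeasurable_funM => //; exact: measurable_kern2.
  have kk0 (d e s : R) : (0 <= (kern d s * kern e (1 - s))%:E)%E.
    by rewrite lee_fin mulr_ge0 ?kern_ge0.
  have Ckk0 (c d e s : R) : (0 <= (C c)%:E * (kern d s * kern e (1 - s))%:E)%E.
    by rewrite mule_ge0// lee_fin.
  rewrite /Beta -!ge0_integralZl ?lee_fin//; try exact: measurable_kern2.
  rewrite -ge0_integralD//; try exact: mC.
  apply: ge0_le_integral => //.
  - exact: measurable_kern2.
  - by apply: emeasurable_funD; exact: mC.
  move=> s _; rewrite -!EFinM -EFinD lee_fin.
  case: (ltP s 0) => s0.
    by rewrite !(kern_lt0 _ s0) !(mul0r,mulr0) addr0.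
  case: (ltP (1 - s) 0) => s1.
    by rewrite !(kern_lt0 _ s1) !(mul0r,mulr0) addr0.
  rewrite !kern1// mul1r mulr1.
  case: (leP 2^-1 s) => s2.
    by rewrite ler_wpDr ?mulr_ge0 ?kern_ge0// ler_wpM2r ?kern_ge0// hC.
  rewrite ler_wpDl ?mulr_ge0 ?kern_ge0// mulrC ler_wpM2r ?kern_ge0// hC//.
  lra.
by rewrite Beta_sym !Beta_1// -!EFinM -EFinD ltry.
Qed.

Lemma Beta_gt0 a b : 0 < a -> a <= 1 -> 0 < b -> b <= 1 -> (0 < Beta a b)%E.
Proof.
move=> a0 a1 b0 b1.
have kk0 s : (0 <= (kern a s * kern b (1 - s))%:E)%E.
  by rewrite lee_fin mulr_ge0 ?kern_ge0.
apply: (@lt_le_trans _ _ (\int[mu]_(x in `]0%R, 1%R[) (cst 1%E x))%E).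
  by rewrite integral_cst//= lebesgue_measure_itv/= lte_fin ltr01 sube0 mule1.
apply: (@le_trans _ _ (\int[mu]_(x in `]0%R, 1%R[) (kern a x * kern b (1 - x))%:E)%E).
  apply: ge0_le_integral => //.
    by apply: measurable_funTS; exact: measurable_kern2.
  move=> x; rewrite /= in_itv/= => /andP[x0 x1].
  have k1 c (y : R) : c <= 1 -> 0 < y -> y <= 1 -> 1 <= kern c y.
    move=> c1 y0 y1; rewrite kern_gt0E//.
    rewrite -[X in X <= _](powRr0 y) ger_powR ?y0 ?y1//; lra.
  by rewrite lee_fin mulr_ege1// k1//; lra.
by apply: ge0_subset_integral => //; exact: measurable_kern2.
Qed.

(** * Euler's relation between Gamma and Beta *)

Definition gamma_density b (u : R) : R := kern b u * expR (- u).

Lemma gamma_density_ge0 b u : 0 <= gamma_density b u.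
Proof. by rewrite mulr_ge0 ?kern_ge0 ?expR_ge0. Qed.

Lemma measurable_gamma_density b : measurable_fun [set: R] (gamma_density b).
Proof.
apply: measurable_funM; first exact: measurable_kern.
by apply: measurableT_comp => //; exact: measurable_funN.
Qed.

Lemma GammaE b : Gamma b = fine (\int[mu]_u (gamma_density b u)%:E).
Proof.
rewrite /Gamma /Rintegral; congr fine.
rewrite integral_itv_obnd_cbnd; last first.
  apply: measurable_funTS; apply/measurable_EFinP; apply: measurable_funM.
    exact: measurable_powR.
  by apply: measurableT_comp => //; exact: measurable_funN.
rewrite integral_mkcond; apply: eq_integral => s _.
rewrite patchE mem_setE in_itv/= andbT /gamma_density /kern.
by case: (0 <= s); rewrite ?mul0r.
Qed.

Lemma integral_gamma_density1 : (\int[mu]_u (gamma_density 1 u)%:E = 1)%E.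
Proof.
rewrite -(@integral_exponential_pdf R 1 ltr01); apply: eq_integral => u _.
congr EFin; rewrite /gamma_density; case: (ltP u 0) => u0.
  by rewrite kern_lt0// mul0r lt0_exponential_pdf.
by rewrite kern1// exponential_pdfE// !mul1r mulN1r.
Qed.

Lemma gamma_density_conv a b w s :
  gamma_density a s * gamma_density b (w - s) =
  expR (- w) * (kern a s * kern b (w - s)).
Proof.
rewrite /gamma_density mulrACA mulrC -expRD; congr (expR _ * _); ring.
Qed.

Lemma measurable_gamma_density2 a b :
  measurable_fun [set: R * R]
    (fun sw : R * R => (gamma_density a sw.1 * gamma_density b (sw.2 - sw.1))%:E).
Proof.
apply/measurable_EFinP; apply: measurable_funM.
  by apply: measurableT_comp => //; exact: measurable_gamma_density.
apply: measurableT_comp; first exact: measurable_gamma_density.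
exact: measurable_funB.
Qed.

(** Write the product as a double integral in s and w = r + s: the exponentials
    combine into exp(-w), and the integral over s is the convolution of the
    kernels, which is constant in w as a + b = 1. *)
Lemma Gamma_Beta a b : a + b = 1 ->
  (\int[mu]_u (gamma_density a u)%:E * \int[mu]_u (gamma_density b u)%:E = Beta a b)%E.
Proof.
move=> ab.
have g0 c u : (0 <= (gamma_density c u)%:E)%E by rewrite lee_fin gamma_density_ge0.
have mg c : measurable_fun [set: R] (fun u => (gamma_density c u)%:E).
  by apply/measurable_EFinP; exact: measurable_gamma_density.
rewrite -ge0_integralZr//; [|exact: mg|exact: integral_ge0].
transitivity (\int[mu]_s \int[mu]_w
    (gamma_density a s * gamma_density b (w - s))%:E)%E.
  apply: eq_integral => s _.
  rewrite -[in LHS](ge0_integral_shift s)// -ge0_integralZl//.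
  apply/measurable_EFinP; apply: measurableT_comp; last exact: measurable_funB.
  exact: measurable_gamma_density.
pose f (sw : measurableTypeR R * measurableTypeR R) :=
  (gamma_density a sw.1 * gamma_density b (sw.2 - sw.1))%:E.
transitivity (\int[mu]_w \int[mu]_s f (s, w))%E.
  apply: (@fubini_tonelli _ _ _ _ R mu mu f).
  - exact: measurable_gamma_density2.
  - by move=> x; rewrite /f EFinM mule_ge0.
rewrite /f/=.
transitivity (\int[mu]_w (Beta a b * (gamma_density 1 w)%:E))%E; last first.
  by rewrite ge0_integralZl ?Beta_ge0//; [rewrite integral_gamma_density1 mule1|exact: mg].
apply: ae_eq_integral => //.
- apply: (@measurable_fun_fubini_tonelli_G _ _ _ _ R mu f).
  + exact: measurable_gamma_density2.
  + by move=> x; rewrite /f EFinM mule_ge0.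
- by apply: emeasurable_funM => //; exact: mg.
apply: (@ae_eq_off_point 0) => w w0.
under eq_integral do rewrite gamma_density_conv EFinM.
rewrite ge0_integralZl ?lee_fin ?expR_ge0//; last 2 first.
- exact: measurable_kern2.
- by move=> x _; rewrite lee_fin mulr_ge0 ?kern_ge0.
by rewrite kern_convolution0 ?w0// ab muleCA -EFinM mulrC.
Qed.

Definition beta a b : R := fine (Beta a b).

Lemma beta_ge0 a b : 0 <= beta a b.
Proof. by rewrite fine_ge0// Beta_ge0. Qed.

Lemma betaE a b : 0 < a -> a <= 1 -> 0 < b -> b <= 1 -> Beta a b = (beta a b)%:E.
Proof.
by move=> *; rewrite /beta fineK// ge0_fin_numE ?Beta_ge0// Beta_fin.
Qed.

Lemma beta_1 b : 0 < b -> beta b 1 = b^-1.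
Proof. by move=> b0; rewrite /beta Beta_1. Qed.

(** Finiteness of the two Gamma integrals is deduced rather than proved
    directly: their product is finite and positive, so neither can be infinite. *)
Lemma beta_Gamma a b : 0 < a -> 0 < b -> a + b = 1 ->
  beta a b = Gamma a * Gamma b /\ 0 < beta a b.
Proof.
move=> a0 b0 ab; have [a1 b1] : a <= 1 /\ b <= 1 by split; lra.
have B0 := Beta_gt0 a0 a1 b0 b1.
have := Gamma_Beta ab; rewrite !GammaE betaE// in B0 *.
have I0 c : (0 <= \int[mu]_u (gamma_density c u)%:E)%E.
  by apply: integral_ge0 => u _; rewrite lee_fin gamma_density_ge0.
move: (I0 a) (I0 b); move: (\int[mu]_u _)%E (\int[mu]_u _)%E => [y| |] [x| |] //=.
- by move=> _ _; rewrite -EFinM => -[xy]; split => //; rewrite -lte_fin.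
- move=> _; rewrite lee_fin le_eqVlt => /orP[/eqP <-|y0]; last by rewrite gt0_mulye ?lte_fin.
  by rewrite mule0 => -[Be]; move: B0; rewrite -Be ltxx.
- rewrite lee_fin le_eqVlt => /orP[/eqP <- _|x0 _]; last by rewrite gt0_muley ?lte_fin.
  by rewrite mul0e => -[Be]; move: B0; rewrite -Be ltxx.
Qed.

(** * Fractional integrals as convolutions, and their composition *)

Definition kint b (g : R -> R) t : R := \int[mu]_s (kern b (t - s) * g s).

Definition kintegrable b (g : R -> R) t : Prop :=
  mu.-integrable [set: R] (EFin \o (fun s => kern b (t - s) * g s)).

Lemma integrable_kern_convolution a b t tau : 0 < a -> a <= 1 -> 0 < b -> b <= 1 ->
  (t != tau) || (a + b != 1) ->
  mu.-integrable [set: R] (EFin \o (fun s => kern a (t - s) * kern b (s - tau))).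
Proof.
move=> a0 a1 b0 b1 ttau; apply/integrableP; split.
  apply/measurable_EFinP/measurable_funM; first exact: measurable_kernl.
  exact: measurable_kernr.
under eq_integral do rewrite /= ger0_norm ?mulr_ge0 ?kern_ge0//.
by rewrite kern_convolution// betaE// -EFinM ltry.
Qed.

(** Fubini's theorem.  The double integral of the absolute value is a multiple of
    the integral of order a + b of the absolute value of g, so convergence at t
    of that integral is what makes the exchange legitimate. *)
Lemma kint_comp a b (g : R -> R) t : 0 < a -> a <= 1 -> 0 < b -> b <= 1 ->
  measurable_fun [set: R] g -> (forall s, kintegrable b g s) ->
  kintegrable (a + b) g t ->
  kintegrable a (kint b g) t /\ kint a (kint b g) t = beta a b * kint (a + b) g t.
Proof.
move=> a0 a1 b0 b1 mg bg abg.
pose f (x : measurableTypeR R * measurableTypeR R) :=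
  (kern a (t - x.1) * (kern b (x.1 - x.2) * g x.2))%:E.
have mf : measurable_fun setT f.
  apply/measurable_EFinP; apply: measurable_funM.
    by apply: measurableT_comp; [exact: measurable_kern|exact: measurable_funB].
  apply: measurable_funM; last by apply: measurableT_comp.
  by apply: measurableT_comp; [exact: measurable_kern|exact: measurable_funB].
have fE s : (\int[mu]_tau f (s, tau) = (kern a (t - s) * kint b g s)%:E)%E.
  rewrite /f/=; under eq_integral do rewrite EFinM.
  rewrite integralZl//; last exact: bg.
  rewrite EFinM; congr (_ * _)%E.
  by rewrite /kint /Rintegral fineK//; exact: integrable_fin_num (bg s).
have Ef tau : tau != t ->
    (\int[mu]_s f (s, tau) = (beta a b)%:E * (kern (a + b) (t - tau) * g tau)%:E)%E.
  move=> ttau; rewrite /f/=; under eq_integral do rewrite mulrA EFinM.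
  rewrite integralZr//; last by apply: integrable_kern_convolution => //; rewrite eq_sym ttau.
  by rewrite kern_convolution 1?eq_sym ?ttau// betaE// EFinM muleA.
have Efabs tau : tau != t ->
    (\int[mu]_s `|f (s, tau)| = (beta a b)%:E * (`|kern (a + b) (t - tau) * g tau|)%:E)%E.
  move=> ttau; rewrite normrM ger0_norm ?kern_ge0//.
  rewrite EFinM muleA -betaE// -kern_convolution 1?eq_sym ?ttau//.
  rewrite -ge0_integralZr//; last 2 first.
  - apply/measurable_EFinP/measurable_funM; first exact: measurable_kernl.
    exact: measurable_kernr.
  - by move=> s _; rewrite lee_fin mulr_ge0 ?kern_ge0.
  apply: eq_integral => s _; rewrite /f/= -EFinM !normrM.
  by rewrite !(ger0_norm (kern_ge0 _ _)) mulrA.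
move: (abg) => /integrableP[mabg iabg].
have mabs : measurable_fun [set: R] (fun tau => (`|kern (a + b) (t - tau) * g tau|)%:E).
  by apply/measurable_EFinP; apply: measurableT_comp => //; exact/measurable_EFinP.
have intf : (mu \x mu)%E.-integrable setT f.
  apply/integrable21ltyP => //.
  rewrite (ae_eq_integral (fun tau : measurableTypeR R =>
    (beta a b)%:E * (`|kern (a + b) (t - tau) * g tau|)%:E)%E)//.
  - rewrite ge0_integralZl ?lee_fin ?beta_ge0//.
    by apply: lte_mul_pinfty; rewrite ?lee_fin ?beta_ge0.
  - have := @measurable_fun_fubini_tonelli_G _ _ _ _ R mu (abse \o f).
    by apply; [exact: measurableT_comp|move=> x; exact: abse_ge0].
  - by apply: emeasurable_funM.
  - exact: (@ae_eq_off_point t).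
split.
  have := integrable_fubini_F intf.
  by rewrite /fubini_F (funext fE).
have := Fubini intf.
rewrite (funext fE) /= => FE.
rewrite /kint {1}/Rintegral FE.
rewrite (ae_eq_integral (fun tau : measurableTypeR R =>
    (beta a b)%:E * (kern (a + b) (t - tau) * g tau)%:E)%E)//.
- by rewrite integralZl// fineM//; exact: integrable_fin_num.
- exact: (measurable_fubini_G intf).
- by apply: emeasurable_funM.
- exact: (@ae_eq_off_point t).
Qed.

End kernel.

(** * Hoelder continuity of fractional integrals of bounded functions *)

Section bounded_density.
Context {R : realType}.
Local Notation mu := (@lebesgue_measure R).
Implicit Types (a b s t u w : R).

Lemma kern_homo b : 0 <= b -> {homo @kern R (b + 1) : u w / u <= w}.
Proof.
move=> b0 u w uw; rewrite /kern addrK; case: (ltP u 0) => u0.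
  by case: ifP => // _; exact: powR_ge0.
have w0 := le_trans u0 uw.
by rewrite w0; apply: ge0_ler_powR; rewrite ?nnegrE.
Qed.

Lemma kern_decr b u w : b <= 1 -> 0 < u -> u <= w -> kern b w <= kern b u.
Proof.
move=> b1 u0 uw; have w0 := lt_le_trans u0 uw.
rewrite !kern_gt0E// -[b - 1]opprB !powRN lef_pV2 ?posrE ?powR_gt0//.
by apply: ge0_ler_powR; rewrite ?nnegrE ?subr_ge0//; exact: ltW.
Qed.

Lemma kern1_le1 u : kern 1 u <= 1.
Proof. by rewrite /kern subrr powRr0; case: ifP. Qed.

Section integrals_of_real_functions.
Variable (D : set (measurableTypeR R)) (mD : measurable D).
Implicit Types f g : R -> R.
Local Notation itg f := (mu.-integrable D (EFin \o f)).

Lemma integrable_EFinD f g : itg f -> itg g -> itg (fun x => f x + g x).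
Proof. by move=> fi gi; exact: (integrableD mD fi gi). Qed.

Lemma integrable_EFinB f g : itg f -> itg g -> itg (fun x => f x - g x).
Proof. by move=> fi gi; exact: (integrableB mD fi gi). Qed.

Lemma integrable_EFinZ (c : R) f : itg f -> itg (fun x => c * f x).
Proof. by move=> fi; exact: (integrableZl mD c fi). Qed.

Lemma integrable_EFin_le f g : measurable_fun D f -> itg g ->
  (forall x, D x -> `|f x| <= g x) -> itg f.
Proof.
move=> mf gi fg; apply: le_integrable gi => //; first exact/measurable_EFinP.
by move=> x Dx /=; rewrite lee_fin (le_trans (fg _ Dx))// ler_norm.
Qed.

Lemma norm_Rintegral_le f g : measurable_fun D f -> itg g ->
  (forall x, D x -> `|f x| <= g x) ->
  `|\int[mu]_(x in D) f x| <= \int[mu]_(x in D) g x.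
Proof.
move=> mf gi fg; have fi := integrable_EFin_le mf gi fg.
apply: (le_trans (le_normr_Rintegral mD fi)); apply: le_Rintegral => //.
exact: integrable_norm.
Qed.

End integrals_of_real_functions.

(** The step [kern 1 (s - t0)] dominates every bounded function that vanishes to
    the left of t0, so this explicit value yields all the estimates below. *)
Lemma kint_step b t t0 : 0 < b -> b <= 1 ->
  kintegrable b (fun s => kern 1 (s - t0)) t /\
  kint b (fun s => kern 1 (s - t0)) t = b^-1 * kern (b + 1) (t - t0).
Proof.
move=> b0 b1; have b11 : b + 1 != 1 by rewrite addrC -subr_eq0 addrAC subrr add0r gt_eqF.
split; first by apply: integrable_kern_convolution; rewrite ?b11 ?orbT.
by rewrite /kint /Rintegral kern_convolution ?b11 ?orbT// betaE// beta_1.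
Qed.

Section bounded.
Variables (g : R -> R) (t0 M : R).
Hypothesis mg : measurable_fun [set: R] g.
Hypothesis gM : forall s, `|g s| <= M * kern 1 (s - t0).

Let M0 : 0 <= M.
Proof. by have := le_trans (normr_ge0 _) (gM t0); rewrite subrr kern1// mulr1. Qed.

Let mkg b t : measurable_fun [set: R] (fun s => kern b (t - s) * g s).
Proof. by apply: measurable_funM => //; exact: measurable_kernl. Qed.

Let kgM b t s : `|kern b (t - s) * g s| <= M * (kern b (t - s) * kern 1 (s - t0)).
Proof.
rewrite normrM ger0_norm ?kern_ge0// mulrCA ler_wpM2l ?kern_ge0//.
Qed.

Lemma kintegrable_bounded b t : 0 < b -> b <= 1 -> kintegrable b g t.
Proof.
move=> b0 b1; have [ci _] := kint_step t t0 b0 b1.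
exact: (integrable_EFin_le measurableT (mkg b t) (integrable_EFinZ measurableT M ci)
  (fun s _ => kgM b t s)).
Qed.

Lemma kint_bounded b t : 0 < b -> b <= 1 ->
  `|kint b g t| <= M / b * kern (b + 1) (t - t0).
Proof.
move=> b0 b1; have [ci ce] := kint_step t t0 b0 b1.
rewrite -mulrA -ce /kint -RintegralZl//.
exact: (norm_Rintegral_le measurableT (mkg b t) (integrable_EFinZ measurableT M ci)
  (fun s _ => kgM b t s)).
Qed.

(** For s < t the kernel at t' is below the one at t, so the absolute value of
    the increment is a difference of kernels, integrated exactly by [kint_step];
    from t to t' only the kernel at t' is present, and it integrates to a
    multiple of (t' - t)^b. *)
Lemma kint_hoelder b t t' : 0 < b -> b < 1 -> t <= t' ->
  `|kint b g t' - kint b g t| <= 2 * M / b * (t' - t) `^ b.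
Proof.
move=> b0 b1 tt'; have b1' := ltW b1.
have [i1 e1] := kint_step t t0 b0 b1'.
have [i2 e2] := kint_step t' t0 b0 b1'.
have [i3 e3] := kint_step t' t b0 b1'.
pose G s := M * (kern b (t - s) * kern 1 (s - t0) - kern b (t' - s) * kern 1 (s - t0)
  + 2 * (kern b (t' - s) * kern 1 (s - t))).
have i12 := integrable_EFinB measurableT i1 i2.
have i3' := integrable_EFinZ measurableT 2 i3.
have i123 := integrable_EFinD measurableT i12 i3'.
have iG : mu.-integrable [set: R] (EFin \o G) by exact: integrable_EFinZ.
have GE : \int[mu]_s G s = M * (kint b (fun s => kern 1 (s - t0)) t -
   kint b (fun s => kern 1 (s - t0)) t' + 2 * kint b (fun s => kern 1 (s - t)) t').
  by rewrite /G RintegralZl// RintegralD// RintegralB// RintegralZl.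
rewrite /kint -RintegralB//; [|exact: kintegrable_bounded|exact: kintegrable_bounded].
apply: (@le_trans _ _ (\int[mu]_s G s)).
  apply: (norm_Rintegral_le measurableT _ iG); first by apply: measurable_funB; exact: mkg.
  (* the term with factor 2 corrects the sign on the interval from t to t' *)
  move=> s _; rewrite -mulrBl normrM.
  apply: (le_trans (ler_wpM2l (normr_ge0 _) (gM s))).
  rewrite mulrCA ler_wpM2l//.
  have k1 := kern_ge0 1 (s - t0).
  case: (ltP s t) => st.
    have dk : kern b (t' - s) <= kern b (t - s).
      by apply: kern_decr; rewrite ?subr_gt0// lerB.
    rewrite ler0_norm ?subr_le0// opprB mulrBl lerDl.
    by rewrite mulr_ge0// mulr_ge0// kern_ge0.
  have -> : kern b (t - s) = 0 by rewrite kern_le0 ?subr_le0// lt_eqF.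
  rewrite subr0 ger0_norm ?kern_ge0// mul0r (_ : kern 1 (s - t) = 1) ?mulr1; last first.
    by rewrite kern1// subr_ge0.
  have : kern b (t' - s) * kern 1 (s - t0) <= kern b (t' - s).
    by rewrite ler_piMr ?kern_ge0// kern1_le1.
  by move=> kk; rewrite sub0r [leRHS]addrC lerBrDr mulr_natl mulr2n lerD.
have k3 : kern (b + 1) (t' - t) = (t' - t) `^ b by rewrite /kern subr_ge0 tt' addrK.
rewrite GE e1 e2 e3 k3.
have -> : 2 * M / b * (t' - t) `^ b = M * (2 * (b^-1 * (t' - t) `^ b)) by ring.
apply: ler_wpM2l => //.
rewrite gerDr subr_le0 ler_wpM2l ?invr_ge0 ?(ltW b0)//.
exact: (kern_homo (ltW b0) (lerB tt' (lexx t0))).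
Qed.

Lemma kint_continuous b : 0 < b -> b < 1 -> continuous (kint b g).
Proof.
move=> b0 b1 t; apply/cvgrPdist_le => e e0.
pose C := 2 * M / b.
have C0 : 0 <= C by rewrite !mulr_ge0// invr_ge0 ltW.
have [d d0 Cd] : exists2 d : R, 0 < d & C * d `^ b <= e.
  (* C + 1 instead of C, which may vanish *)
  exists ((e / (C + 1)) `^ b^-1); first by apply: powR_gt0; rewrite divr_gt0// ltr_wpDl.
  rewrite -powRrM mulVf ?gt_eqF// powRr1; last by rewrite divr_ge0 ?addr_ge0// ltW.
  rewrite mulrCA; apply: ler_piMr; first exact: ltW.
  by rewrite ler_pdivrMr ?ltr_wpDl// mul1r lerDl.
near=> s.
have st : `|t - s| <= d by near: s; apply: cvgr_dist_le.
have le_d u : 0 <= u -> u <= d -> C * u `^ b <= e.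
  move=> u0 ud; apply: le_trans Cd; rewrite ler_wpM2l//.
  by apply: ge0_ler_powR; rewrite ?nnegrE// ltW.
case: (leP s t) => [lest|/ltW lets].
  by apply: (le_trans (kint_hoelder b0 b1 lest)); rewrite le_d ?subr_ge0// (le_trans (ler_norm _)).
rewrite distrC; apply: (le_trans (kint_hoelder b0 b1 lets)).
by rewrite le_d ?subr_ge0// (le_trans _ st)// distrC ler_norm.
Unshelve. all: by end_near. Qed.

End bounded.
End bounded_density.

(** * Left derivative of a fractional integral where it is singular *)

Section endpoint.
Context {R : realType}.
Local Notation mu := (@lebesgue_measure R).
Implicit Types (a b s t u w : R).

Lemma left_quotient_cvg (F : R -> R) (x d : R) : is_derive x 1 F d ->
  (fun n : nat => (F x - F (x - n.+1%:R^-1)) / n.+1%:R^-1) @ \oo --> d.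
Proof.
move=> [dF dE].
have e0 : (fun n : nat => - (n.+1%:R^-1 : R)) @ \oo --> (0 : R).
  by rewrite -[X in _ --> X]oppr0; apply: cvgN; exact: cvg_harmonic.
have e0' : (fun n : nat => - (n.+1%:R^-1 : R)) @ \oo --> (0 : R)^'.
  move=> A nA; suff: \forall n \near \oo, A (- (n.+1%:R^-1 : R)) by [].
  have : \forall n \near \oo, - (n.+1%:R^-1 : R) != 0 -> A (- n.+1%:R^-1) := e0 _ nA.
  apply: filterS => n; apply.
  by rewrite oppr_eq0 invr_eq0 pnatr_eq0.
have := cvg_comp _ _ e0' dF; rewrite -/(derive F x 1) dE.
apply: cvg_trans; apply: near_eq_cvg; near=> n => /=.
rewrite -[_ *: 1]/(_ * 1) mulr1 [- _ + x]addrC /GRing.scale/=.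
by rewrite invrN mulNr -mulrN opprB mulrC.
Unshelve. all: by end_near. Qed.

Lemma is_derive_kern b u : 0 < u -> is_derive u 1 (kern (b + 1)) (b * kern b u).
Proof.
move=> u0; rewrite kern_gt0E//.
apply: (@near_eq_is_derive _ _ _ (fun x => x `^ b)).
- near=> x; rewrite kern_gt0E ?addrK//; near: x; exact: lt_nbhsr.
- exact: is_derive1_powR.
Unshelve. all: by end_near. Qed.

(** The bound by [kern b u], without a constant and uniformly in e, is what makes
    dominated convergence applicable under the mere convergence of the integral
    of order b.  It amounts to [u^(b-1) * (u - e) <= (u - e)^b] for u > e. *)
Lemma kern_quotient_le b u (e : R) : 0 < b -> b < 1 -> 0 < e ->
  `|(kern (b + 1) u - kern (b + 1) (u - e)) / e| <= kern b u.
Proof.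
move=> b0 b1 e0.
have mono : kern (b + 1) (u - e) <= kern (b + 1) u.
  by apply: kern_homo; [exact: ltW|rewrite gerBl; exact: ltW].
rewrite ger0_norm; last by rewrite divr_ge0 ?subr_ge0// ltW.
rewrite ler_pdivrMr//.
case: (leP u 0) => u0.
  have -> : kern (b + 1) u = 0 by rewrite kern_le0// -subr_eq0 addrK gt_eqF.
  rewrite sub0r (le_trans (y := 0)) ?oppr_le0 ?kern_ge0//.
  by rewrite mulr_ge0 ?kern_ge0// ltW.
have kE : kern (b + 1) u = u * kern b u.
  by rewrite !kern_gt0E// addrK mulr_powRB1// ltW.
rewrite kE lerBlDr -lerBlDl mulrC -mulrBr.
case: (leP u e) => ue.
  rewrite (le_trans (y := 0)) ?kern_ge0// mulr_ge0_le0 ?kern_ge0// subr_le0//.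
have v0 : 0 < u - e by rewrite subr_gt0.
have -> : kern (b + 1) (u - e) = (u - e) * kern b (u - e).
  by rewrite !kern_gt0E// addrK mulr_powRB1// ltW.
rewrite mulrC ler_wpM2l ?(ltW v0)// kern_decr//; first exact: ltW.
by rewrite gerBl ltW.
Qed.

Lemma kintegrable_supported b (h : R -> R) t0 t : 0 <= b ->
  mu.-integrable [set: R] (EFin \o h) -> (forall s, s < t0 -> h s = 0) ->
  kintegrable (b + 1) h t.
Proof.
move=> b0 hi h0; have mh : measurable_fun [set: R] h.
  by apply/measurable_EFinP; exact: measurable_int hi.
have hn := integrable_norm hi.
apply: (integrable_EFin_le measurableT _
  (integrable_EFinZ measurableT (kern (b + 1) (t - t0)) hn)).
  by apply: measurable_funM => //; exact: measurable_kernl.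
move=> s _ /=; rewrite normrM ger0_norm ?kern_ge0//.
case: (ltP s t0) => st; first by rewrite h0// normr0 !mulr0.
by rewrite ler_wpM2r// kern_homo// lerB.
Qed.

(** Differentiation under the integral sign at the endpoint t, where the kernel of
    order b is singular; only left increments are controlled by it. *)
Lemma kint_left_derivative b (h : R -> R) t : 0 < b -> b < 1 ->
  measurable_fun [set: R] h -> (forall s, kintegrable (b + 1) h s) ->
  kintegrable b h t ->
  (fun n : nat => (kint (b + 1) h t - kint (b + 1) h (t - n.+1%:R^-1)) / n.+1%:R^-1)
    @ \oo --> b * kint b h t.
Proof.
move=> b0 b1 mh b1h bh.
pose q (n : nat) (s : R) :=
  (kern (b + 1) (t - s) - kern (b + 1) (t - n.+1%:R^-1 - s)) / n.+1%:R^-1.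
pose f_ (n : nat) (s : R) := (q n s * h s)%:E.
pose f (s : R) := (b * (kern b (t - s) * h s))%:E.
have Ei n : (\int[mu]_s f_ n s =
    ((kint (b + 1) h t - kint (b + 1) h (t - n.+1%:R^-1)) / n.+1%:R^-1)%:E)%E.
  have iB := integrable_EFinB measurableT (b1h t) (b1h (t - n.+1%:R^-1)).
  have iZ := integrable_EFinZ measurableT n.+1%:R iB.
  rewrite /kint -(RintegralB _ (b1h t) (b1h (t - n.+1%:R^-1)))//.
  rewrite invrK mulrC -(RintegralZl _ _ iB)//.
  rewrite /Rintegral fineK; last exact: integrable_fin_num iZ.
  by apply: eq_integral => s _; rewrite /f_ /q invrK -mulrBl mulrA [_ * (_ - _)]mulrC.
have Ef : (\int[mu]_s f s = (b * kint b h t)%:E)%E.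
  rewrite /kint -RintegralZl// /Rintegral fineK//.
  by apply: integrable_fin_num => //; exact: (integrable_EFinZ measurableT b bh).
have mq n : measurable_fun [set: R] (q n).
  apply: measurable_funM => //.
  by apply: measurable_funB; exact: measurable_kernl.
have mf_ n : measurable_fun [set: measurableTypeR R] (f_ n).
  by apply/measurable_EFinP; apply: measurable_funM => //; exact: mq.
have mf : measurable_fun [set: measurableTypeR R] f.
  apply/measurable_EFinP; apply: measurable_funM => //.
  by apply: measurable_funM => //; exact: measurable_kernl.
have f_f : {ae mu, forall s, [set: measurableTypeR R] s -> f_ ^~ s @ \oo --> f s}.
  apply: aeW => s _; apply: cvg_EFin; first by near=> n.
  rewrite mulrA; apply: cvgMr_tmp; rewrite /q.
  under eq_fun do rewrite [t - _ - s]addrAC.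
  case: (ltP 0 (t - s)) => ts; first exact: left_quotient_cvg (is_derive_kern b ts).
  have b11 : b + 1 != 1 by rewrite -subr_eq0 addrK gt_eqF.
  rewrite (@kern_le0 _ b)// ?lt_eqF// mulr0; apply: cvg_near_cst; near=> n.
  by rewrite !kern_le0 ?subrr ?mul0r// subr_le0 (le_trans ts).
have f_le : {ae mu, forall s n, [set: measurableTypeR R] s ->
    (`|f_ n s| <= `|kern b (t - s) * h s|%:E)%E}.
  apply: aeW => s n _; rewrite /f_ /= lee_fin normrM [leRHS]normrM.
  rewrite ler_wpM2r// [leRHS]ger0_norm ?kern_ge0//.
  by rewrite /q [t - _ - s]addrAC kern_quotient_le// invr_gt0.
have [_ _] := dominated_convergence measurableT mf_ mf f_f (integrable_norm bh) f_le.
rewrite Ef => cv.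
have := fine_cvg cv; move=> /(_ eventually_filter).
apply: cvg_trans; apply: near_eq_cvg; near=> n => /=.
by rewrite Ei.
Unshelve. all: by end_near. Qed.

End endpoint.

(** * The Caputo derivative of a solution of a Volterra equation *)

Section riemann_liouville.
Context {R : realType}.
Local Notation mu := (@lebesgue_measure R).
Implicit Types (a b s t u w : R) (f g : R -> R).

(** One restriction of f to [[t0, T]] serves for all t up to T, since the kernel
    cuts off at t by itself. *)
Lemma RL_kernel_kern b f t0 T t : t <= T ->
  RL_kernel b f t \_ `[t0, t] = (fun s => kern b (t - s) * (f \_ `[t0, T]) s).
Proof.
move=> tT; apply/funext => s; rewrite !patchE !mem_setE !in_itv/= /RL_kernel.
case: (leP t0 s) => t0s /=; last by rewrite mulr0.
case: (leP s t) => st; last by rewrite kern_lt0 ?mul0r// subr_lt0.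
by rewrite (le_trans st tT) /kern subr_ge0 st.
Qed.

Lemma RL_integrable_kint b f t0 T t : t <= T ->
  RL_integrable b t0 f t <-> kintegrable b (f \_ `[t0, T]) t.
Proof.
move=> tT; rewrite /RL_integrable /kintegrable -(RL_kernel_kern b f t0 tT).
by rewrite -restrict_EFin; exact: integrable_mkcond.
Qed.

Lemma RL_integral_kint b f t0 T t : t <= T ->
  RL_integral b t0 f t = (Gamma b)^-1 * kint b (f \_ `[t0, T]) t.
Proof.
by move=> tT; rewrite /RL_integral /kint -(RL_kernel_kern b f t0 tT) -Rintegral_mkcond.
Qed.

Lemma kint1_itv g t0 T t : t <= T ->
  kint 1 (g \_ `[t0, T]) t = \int[mu]_(s in `[t0, t]) g s.
Proof.
move=> tT; rewrite /kint -(RL_kernel_kern 1 g t0 tT) -Rintegral_mkcond.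
by apply: eq_Rintegral => s _; rewrite /RL_kernel subrr powRr0 mul1r.
Qed.

Lemma kint_out b g t0 t : (forall s, s < t0 -> g s = 0) -> t < t0 -> kint b g t = 0.
Proof.
move=> g0 t0t; rewrite /kint (_ : (fun s => _) = cst 0) ?Rintegral_cst ?mul0r//.
apply/funext => s; case: (ltP s t0) => st; first by rewrite g0// mulr0.
by rewrite kern_lt0 ?mul0r// subr_lt0 (lt_le_trans t0t).
Qed.

Let eq_kernM b f g t : (forall s, s <= t -> f s = g s) ->
  (fun s => kern b (t - s) * f s) = (fun s => kern b (t - s) * g s).
Proof.
move=> fg; apply/funext => s; case: (leP s t) => st; first by rewrite fg.
by rewrite !kern_lt0 ?mul0r// subr_lt0.
Qed.

Lemma eq_kint b f g t : (forall s, s <= t -> f s = g s) -> kint b f t = kint b g t.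
Proof. by move=> /eq_kernM E; rewrite /kint E. Qed.

Lemma eq_kintegrable b f g t : (forall s, s <= t -> f s = g s) ->
  kintegrable b f t -> kintegrable b g t.
Proof. by move=> /eq_kernM E; rewrite /kintegrable E. Qed.

Lemma kintZ b (c : R) g t : kintegrable b g t ->
  kintegrable b (fun s => c * g s) t /\ kint b (fun s => c * g s) t = c * kint b g t.
Proof.
move=> gi.
have E : (fun s => kern b (t - s) * (c * g s)) = (fun s => c * (kern b (t - s) * g s)).
  by apply/funext => s; rewrite mulrCA.
by rewrite /kintegrable /kint E RintegralZl//; split => //; exact: integrable_EFinZ.
Qed.

Definition bounded_measurable t0 T f : Prop :=
  measurable_fun `[t0, T] f /\ exists M, forall s, t0 <= s <= T -> `|f s| <= M.

Lemma bounded_measurable_patch t0 T f : bounded_measurable t0 T f ->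
  measurable_fun [set: R] (f \_ `[t0, T]) /\
  exists M, forall s, `|(f \_ `[t0, T]) s| <= M * kern 1 (s - t0).
Proof.
move=> [mf [M fM]]; split.
  by apply/(measurable_restrictT f) => //; exact: measurable_itv.
exists (Num.max M 0) => s; rewrite patchE mem_setE in_itv/=.
have M0 : 0 <= Num.max M 0 by rewrite le_max lexx orbT.
case: ifP => [/[dup] sI /andP[t0s _]|_].
  by rewrite kern1 ?subr_ge0// mulr1 le_max fM.
by rewrite normr0 mulr_ge0// kern_ge0.
Qed.

Lemma integrable_bounded_measurable t0 T f : bounded_measurable t0 T f ->
  mu.-integrable `[t0, T] (EFin \o f).
Proof.
move=> /bounded_measurable_patch[mf [M fM]].
have := kintegrable_bounded mf fM T ltr01 (lexx 1).
move=> /(RL_integrable_kint 1 f t0 (lexx T)); rewrite /RL_integrable.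
suff -> : RL_kernel 1 f T = f by [].
by apply/funext => s; rewrite /RL_kernel subrr powRr0 mul1r.
Qed.

(** Abel's identity [J^(1-a) J^a = J^1], without the normalising factors: the
    kernels of orders 1 - a and a convolve to a constant, which is a multiple of
    the kernel of order 1. *)
Lemma kint_abel a g t0 M s : 0 < a -> a < 1 -> measurable_fun [set: R] g ->
  (forall r, `|g r| <= M * kern 1 (r - t0)) ->
  kintegrable (1 - a) (kint a g) s /\
  kint (1 - a) (kint a g) s = Gamma (1 - a) * Gamma a * kint 1 g s.
Proof.
move=> a0 a1 mg gM.
have b0 : 0 < 1 - a by rewrite subr_gt0.
have b1 : 1 - a <= 1 by rewrite gerBl ltW.
have gi c r (c0 : 0 < c) (c1 : c <= 1) : kintegrable c g r :=
  kintegrable_bounded mg gM r c0 c1.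
have g1 : kintegrable (1 - a + a) g s by rewrite subrK; exact: gi.
have [ik ->] := kint_comp b0 b1 a0 (ltW a1) mg (fun r => gi a r a0 (ltW a1)) g1.
by have [-> _] := beta_Gamma b0 a0 (subrK a 1); rewrite subrK.
Qed.

(** An identity of the form [J^b h = v] that is known only after one more
    integration, hence only almost everywhere, still holds at the point t itself
    once the singular integral converges there: b times that integral is the
    left derivative at t of the order-(b+1) integral of h. *)
Lemma kint_endpoint b h t0 t (V : R -> R) (v : R) : 0 < b -> b < 1 ->
  mu.-integrable [set: R] (EFin \o h) -> (forall s, s < t0 -> h s = 0) ->
  kintegrable b h t -> is_derive t 1 V v ->
  (forall s, s <= t -> kint b (kint 1 h) s = Gamma b * V s) ->
  kint b h t = Gamma b * v.
Proof.
move=> b0 b1 ih h0 iht dV hV.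
have mh : measurable_fun [set: R] h.
  by apply/measurable_EFinP; exact: measurable_int ih.
have ihb c s : 0 <= c -> kintegrable (c + 1) h s.
  by move=> c0; exact: kintegrable_supported ih h0.
have ih1 s : kintegrable 1 h s by rewrite -[1]add0r; exact: ihb.
have bn0 : b != 0 by rewrite gt_eqF.
have hE s : s <= t -> kint (b + 1) h s = b * Gamma b * V s.
  move=> /hV hVs; rewrite -mulrA -hVs.
  have [_ ->] := kint_comp b0 (ltW b1) ltr01 (lexx 1) mh ih1 (ihb b s (ltW b0)).
  by rewrite beta_1// mulVKf.
have cbh := kint_left_derivative b0 b1 mh (fun s => ihb b s (ltW b0)) iht.
have cV : (fun n : nat => (kint (b + 1) h t - kint (b + 1) h (t - n.+1%:R^-1)) / n.+1%:R^-1)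
    @ \oo --> b * Gamma b * v.
  apply: cvg_trans; last exact: (cvgMl_tmp (a := b * Gamma b) (left_quotient_cvg dV)).
  apply: near_eq_cvg; near=> n.
  rewrite (hE _ (lexx t)) (hE (t - _)); last by rewrite gerBl.
  by rewrite -mulrBr -[RHS]mulrA.
have E : b * kint b h t = b * Gamma b * v by exact: (cvg_unique _ cbh cV).
by move: E; rewrite -mulrA => /(mulfI bn0).
Unshelve. all: by end_near. Qed.

(** A point T beyond t is needed because the Caputo derivative at t looks at a
    neighbourhood of t. *)
Lemma is_Caputo_volterra a t0 T f g t : 0 < a -> a < 1 -> t0 < t -> t < T ->
  bounded_measurable t0 T g -> {for t, continuous g} ->
  (forall s, t0 <= s <= T -> f s = f t0 + RL_integral a t0 g s) ->
  is_Caputo a t0 f t (g t).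
Proof.
move=> a0 a1 t0t tT bmg gt fE.
have [mG [M GM]] := bounded_measurable_patch bmg.
set G := g \_ `[t0, T] in mG GM.
have b0 : 0 < 1 - a by rewrite subr_gt0.
have b1 : 1 - a < 1 by rewrite gtrBl.
have [BE Bgt0] := beta_Gamma b0 a0 (subrK a 1).
have [Gb0 Ga0] : Gamma (1 - a) != 0 /\ Gamma a != 0.
  by apply/andP; rewrite -negb_or -mulf_eq0 -BE gt_eqF.
have below0 (k : R -> R) (u s : R) : s < t0 -> (k \_ `[t0, u]) s = 0.
  by move=> st; rewrite patchE mem_setE in_itv/= leNgt st.
pose F := (fun r => f r - f t0) \_ `[t0, T].
have FE r : r <= T -> F r = (Gamma a)^-1 * kint a G r.
  move=> rT; case: (ltP r t0) => t0r.
    by rewrite /F below0// (kint_out _ (@below0 g T))// mulr0.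
  by rewrite /F patchE mem_setE in_itv/= t0r rT fE ?t0r// addrC addKr (RL_integral_kint a g t0 rT).
(* both defining expressions of the Caputo derivative are compared with V *)
pose V s := \int[mu]_(r in `[t0, s]) g r.
have FV s : s <= T -> kintegrable (1 - a) F s /\
    kint (1 - a) F s = Gamma (1 - a) * V s.
  move=> sT.
  have F_s r : r <= s -> (Gamma a)^-1 * kint a G r = F r.
    by move=> rs; rewrite FE// (le_trans rs).
  have [iU eU] := kint_abel s a0 a1 mG GM.
  have [iZ eZ] := kintZ (Gamma a)^-1 iU.
  split; first exact: eq_kintegrable F_s iZ.
  by rewrite -(eq_kint (1 - a) F_s) eZ eU kint1_itv// mulrAC mulrC mulfK.
have nbhs_leT : \forall s \near t, s <= T.
  by near=> s; apply: ltW; near: s; exact: lt_nbhsl.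
have dV : is_derive t 1 V (g t).
  have [dV eV] := continuous_FTC1_closed tT (integrable_bounded_measurable bmg) t0t gt.
  by apply: DeriveDef; [exact: dV|rewrite -derive1E; exact: eV].
split.
- near=> s; have sT : s <= T by near: s; exact: nbhs_leT.
  by apply/(RL_integrable_kint _ _ _ sT); exact: (FV s sT).1.
- apply: near_eq_is_derive dV; near=> s.
  have sT : s <= T by near: s; exact: nbhs_leT.
  by rewrite (RL_integral_kint _ _ _ sT) (FV _ sT).2 mulKf.
move=> [ih fh] RLh.
pose H := f^`()%classic \_ `[t0, t].
have iHt : kintegrable (1 - a) H t by apply/RL_integrable_kint.
have iH : mu.-integrable [set: R] (EFin \o H).
  by rewrite /H -restrict_EFin; apply: (iffLR (integrable_mkcond _ _)) ih.
have FH r : r <= t -> F r = kint 1 H r.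
  move=> rt; case: (ltP r t0) => t0r.
    by rewrite /F below0// (kint_out _ (@below0 _ t)).
  rewrite /F patchE mem_setE in_itv/= t0r (le_trans rt (ltW tT)).
  by rewrite fh ?in_itv/= ?t0r// addrC addKr kint1_itv.
rewrite (RL_integral_kint _ _ t0 (lexx t)) -/H.
rewrite (kint_endpoint b0 b1 iH (@below0 _ t) iHt dV) ?mulKf// => s st.
rewrite -(FV s (le_trans st (ltW tT))).2; apply: eq_kint => r rs.
by rewrite FH// (le_trans rs).
Unshelve. all: by end_near. Qed.

End riemann_liouville.

(** * Bounded measurable functions on a segment *)

(** The class in which the Peano--Baker iteration takes place: it contains the
    coefficients, and is stable under products and fractional integration. *)
Section bounded_measurable_algebra.
Context {R : realType}.
Variables (t0 T : R).
Implicit Types (a s t : R) (f g : R -> R).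
Local Notation bm := (@bounded_measurable R t0 T).

Lemma bounded_measurable_cst (c : R) : bm (fun=> c).
Proof. by split; [exact: measurable_cst|exists `|c| => s _]. Qed.

Lemma bounded_measurableD f g : bm f -> bm g -> bm (fun s => f s + g s).
Proof.
move=> [mf [M fM]] [mg [N gN]]; split; first exact: measurable_funD.
exists (M + N) => s sI; apply: (le_trans (ler_normD _ _)).
by apply: lerD; [exact: fM|exact: gN].
Qed.

Lemma bounded_measurableM f g : bm f -> bm g -> bm (fun s => f s * g s).
Proof.
move=> [mf [M fM]] [mg [N gN]]; split; first exact: measurable_funM.
by exists (M * N) => s sI; rewrite normrM ler_pM// ?fM ?gN.
Qed.

Lemma bounded_measurable_sum (J : Type) (r : seq J) (f : J -> R -> R) :
  (forall j, bm (f j)) -> bm (fun s => \sum_(j <- r) f j s).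
Proof.
move=> bf; elim: r => [|j r IH].
  by under [X in bm X]eq_fun do rewrite big_nil; exact: bounded_measurable_cst.
by under [X in bm X]eq_fun do rewrite big_cons; exact: bounded_measurableD.
Qed.

Lemma eq_bounded_measurable f g : (forall s, t0 <= s <= T -> f s = g s) -> bm f -> bm g.
Proof.
move=> fg [mf [M fM]]; split; last by exists M => s sI; rewrite -fg// fM.
apply: eq_measurable_fun mf => s; rewrite inE/= in_itv/=; exact: fg.
Qed.

Lemma continuous_bounded_measurable f : {within `[t0, T], continuous f} -> bm f.
Proof.
move=> cf; split; first exact: subspace_continuous_measurable_fun.
have /compact_bounded[M [_ mrt]] := continuous_compact cf (@segment_compact _ t0 T).
exists (M + 1) => s sI; apply: (mrt (M + 1)); first by rewrite ltrDl.
by exists s => //=; rewrite in_itv.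
Qed.

Section order.
Variable a : R.
Hypotheses (a0 : 0 < a) (a1 : a < 1).

Lemma RL_integral_bound f e t : bm f -> 0 <= e -> (forall s, t0 <= s <= T -> `|f s| <= e) ->
  t <= T -> `|RL_integral a t0 f t| <= `|(Gamma a)^-1| / a * kern (a + 1) (T - t0) * e.
Proof.
move=> bf e0 fe tT.
have [mF _] := bounded_measurable_patch bf.
rewrite (RL_integral_kint _ _ _ tT) normrM -!mulrA ler_wpM2l//.
have Fe s : `|(f \_ `[t0, T]) s| <= e * kern 1 (s - t0).
  rewrite patchE mem_setE in_itv/=; case: ifP => [/[dup] sI /andP[t0s _]|_].
    by rewrite kern1 ?subr_ge0// mulr1 fe.
  by rewrite normr0 mulr_ge0// kern_ge0.
apply: (le_trans (kint_bounded mF Fe t a0 (ltW a1))).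
rewrite -mulrA mulrC -mulrA ler_wpM2l ?invr_ge0 ?(ltW a0)//.
by rewrite ler_wpM2r// kern_homo ?(ltW a0)// lerB.
Qed.

Lemma bounded_measurable_RL f : bm f -> bm (RL_integral a t0 f).
Proof.
move=> bf; have [mF [M FM]] := bounded_measurable_patch bf.
apply: (@eq_bounded_measurable (fun s => (Gamma a)^-1 * kint a (f \_ `[t0, T]) s)).
  by move=> s /andP[_ sT]; rewrite (RL_integral_kint _ _ _ sT).
apply: bounded_measurableM; first exact: bounded_measurable_cst.
apply: continuous_bounded_measurable; apply: continuous_subspaceT.
exact: (kint_continuous mF FM a0 a1).
Qed.

Lemma RL_integral_continuous f t : bm f -> t < T -> {for t, continuous (RL_integral a t0 f)}.
Proof.
move=> bf tT; have [mF [M FM]] := bounded_measurable_patch bf.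
have kc : {for t, continuous (fun s => (Gamma a)^-1 * kint a (f \_ `[t0, T]) s)}.
  by apply: cvgMl_tmp; exact: (kint_continuous mF FM a0 a1).
rewrite /prop_for /continuous_at (RL_integral_kint _ _ _ (ltW tT)).
apply: cvg_trans kc; apply: near_eq_cvg; near=> s.
rewrite (@RL_integral_kint _ _ _ _ T)//; apply: ltW; near: s; exact: lt_nbhsl.
Unshelve. all: by end_near. Qed.

Let bm_kint f t : bm f -> kintegrable a (f \_ `[t0, T]) t.
Proof.
move=> bf; have [mF [M FM]] := bounded_measurable_patch bf.
exact: (kintegrable_bounded mF FM t a0 (ltW a1)).
Qed.

Lemma RL_integralD f g t : bm f -> bm g -> t <= T ->
  RL_integral a t0 (fun s => f s + g s) t = RL_integral a t0 f t + RL_integral a t0 g t.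
Proof.
move=> bf bg tT; rewrite !(RL_integral_kint _ _ _ tT) -mulrDr; congr (_ * _).
rewrite /kint -(RintegralD _ (bm_kint t bf) (bm_kint t bg))//.
apply: eq_Rintegral => s _; rewrite -mulrDr !patchE; case: ifP => //.
by rewrite addr0.
Qed.

Lemma RL_integralZ (c : R) f t : bm f -> t <= T ->
  RL_integral a t0 (fun s => c * f s) t = c * RL_integral a t0 f t.
Proof.
move=> bf tT; rewrite !(RL_integral_kint _ _ _ tT) mulrCA; congr (_ * _).
rewrite -(kintZ c (bm_kint t bf)).2; congr kint; apply/funext => s.
by rewrite !patchE; case: ifP; rewrite ?mulr0.
Qed.

Lemma RL_integral0 t : RL_integral a t0 (fun=> 0) t = 0.
Proof.
rewrite /RL_integral (_ : RL_kernel a _ t = cst 0) ?Rintegral_cst// ?mul0r ?mulr0//.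
by apply/funext => s; rewrite /RL_kernel mulr0.
Qed.

Lemma RL_integral_sum (J : Type) (r : seq J) (f : J -> R -> R) t :
  (forall j, bm (f j)) -> t <= T ->
  RL_integral a t0 (fun s => \sum_(j <- r) f j s) t = \sum_(j <- r) RL_integral a t0 (f j) t.
Proof.
move=> bf tT; elim: r => [|j r IH].
  by under eq_fun do rewrite big_nil; rewrite big_nil RL_integral0.
under eq_fun do rewrite big_cons.
by rewrite big_cons RL_integralD// ?IH//; exact: bounded_measurable_sum.
Qed.

Lemma eq_RL_integral f g t : (forall s, t0 <= s <= t -> f s = g s) ->
  RL_integral a t0 f t = RL_integral a t0 g t.
Proof.
move=> fg; rewrite /RL_integral; congr (_ * _); apply: eq_Rintegral => s.
by rewrite inE/= in_itv/= => sI; rewrite /RL_kernel fg.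
Qed.

Lemma RL_integral_start f : RL_integral a t0 f t0 = 0.
Proof. by rewrite /RL_integral set_itv1 Rintegral_set1 mulr0. Qed.

End order.
End bounded_measurable_algebra.

(** * The Peano--Baker series *)

Section peano_baker.
Context {R : realType}.
Variables (n : nat) (a t0 T : R) (A : R -> 'M[R]_n).
Hypotheses (a0 : 0 < a) (a1 : a < 1).
Local Notation bm := (@bounded_measurable R t0 T).
Local Notation RL := (RL_integral a t0).
Local Notation bmx F := (forall i j, bm (fun s => F s i j)).
Hypothesis bA : bmx A.

Lemma bounded_measurable_mulmx p (B : R -> 'M[R]_(n, p)) : (forall i j, bm (fun s => B s i j)) ->
  forall i j, bm (fun s => (A s *m B s) i j).
Proof.
move=> bB i j; under [X in bm X]eq_fun do rewrite mxE.
by apply: bounded_measurable_sum => k; exact: bounded_measurableM.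
Qed.

Lemma bounded_measurable_PB_term k : bmx (PB_term a A t0 k).
Proof.
elim: k => [|k IH] i j /=; first exact: bounded_measurable_cst.
under [X in bm X]eq_fun do rewrite mxE.
by apply: bounded_measurable_RL => //; exact: bounded_measurable_mulmx.
Qed.

Lemma PB_partial_sumS N t : PB_partial_sum a A t0 N.+1 t =
  PB_partial_sum a A t0 N t + PB_term a A t0 N t.
Proof. by rewrite /PB_partial_sum seriesSr. Qed.

Lemma bounded_measurable_PB_partial_sum N : bmx (PB_partial_sum a A t0 N).
Proof.
move=> i j; elim: N => [|N IH].
  apply: eq_bounded_measurable (bounded_measurable_cst t0 T 0) => s _.
  by rewrite /PB_partial_sum /series/= big_geq// mxE.
apply: eq_bounded_measurable (bounded_measurableD IH (bounded_measurable_PB_term N i j)) => s _.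
by rewrite PB_partial_sumS mxE.
Qed.

Lemma PB_partial_sum_rec N t i j : t0 <= t <= T ->
  PB_partial_sum a A t0 N.+1 t i j =
  (1%:M : 'M[R]_n) i j + RL (fun s => (A s *m PB_partial_sum a A t0 N s) i j) t.
Proof.
move=> /andP[t0t tT]; elim: N => [|N IH].
  rewrite PB_partial_sumS mxE [X in X + _](_ : _ = 0) ?add0r; last first.
    by rewrite /PB_partial_sum /series/= big_geq// mxE.
  rewrite (@eq_RL_integral _ t0 a _ (fun=> 0)) ?RL_integral0 ?addr0// => s _.
  by rewrite /PB_partial_sum /series/= big_geq// mulmx0 mxE.
rewrite PB_partial_sumS mxE IH -addrA; congr (_ + _).
have bS := bounded_measurable_mulmx (bounded_measurable_PB_partial_sum N) i j.
have bP := bounded_measurable_mulmx (bounded_measurable_PB_term N) i j.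
rewrite [X in _ + X]mxE -(RL_integralD a0 a1 bS bP tT).
apply: eq_RL_integral => s _; by rewrite PB_partial_sumS mulmxDr [RHS]mxE.
Qed.

Variable Phi : R -> 'M[R]_n.
Hypothesis Phi_unif : forall e : R, 0 < e -> \forall N \near \oo,
  forall s, t0 <= s <= T -> forall i j, `|Phi s i j - PB_partial_sum a A t0 N s i j| < e.

Lemma bounded_measurable_Phi : bmx Phi.
Proof.
move=> i j; split; last first.
  have [N _ /(_ _ (leqnn N)) SN] := Phi_unif ltr01.
  have [_ [M SM]] := bounded_measurable_PB_partial_sum N i j.
  exists (1 + M) => s sI.
  rewrite -[Phi s i j](subrK (PB_partial_sum a A t0 N s i j)).
  by apply: (le_trans (ler_normD _ _)); apply: lerD; [exact/ltW/SN|exact: SM].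
apply: (measurable_fun_cvg (h := fun N s => PB_partial_sum a A t0 N s i j)).
  by move=> N; have [] := bounded_measurable_PB_partial_sum N i j.
move=> s; rewrite /= in_itv/= => sI; apply/cvgrPdist_lt => e e0.
by apply: filterS (Phi_unif e0) => N; exact.
Qed.

(** The shifted partial sums converge to both sides: to the left one by
    assumption, to the right one by the recursion and the uniform bound on the
    fractional integral. *)
Lemma Phi_volterra t i j : t0 <= t <= T ->
  Phi t i j = (1%:M : 'M[R]_n) i j + RL (fun s => (A s *m Phi s) i j) t.
Proof.
move=> tI; have /andP[t0t tT] := tI.
have [M AM] : exists M, forall k s, t0 <= s <= T -> `|A s i k| <= M.
  have /choice[M AM] : forall k, exists M, forall s, t0 <= s <= T -> `|A s i k| <= M.
    by move=> k; have [_] := bA i k.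
  exists (\sum_k `|M k|) => k s sI; apply: (le_trans (AM _ _ sI)).
  rewrite (bigD1 k)//= (le_trans (ler_norm _))// lerDl.
  by apply: sumr_ge0.
have M0 : 0 <= n%:R * M.
  rewrite mulr_ge0// ?ler0n//; exact: le_trans (normr_ge0 _) (AM i t tI).
pose K := `|(Gamma a)^-1| / a * kern (a + 1) (T - t0).
have K0 : 0 <= K by rewrite !mulr_ge0 ?invr_ge0 ?kern_ge0// ltW.
have S1 : (fun N => PB_partial_sum a A t0 N.+1 t i j) @ \oo --> Phi t i j.
  rewrite (cvg_shiftS (fun N => PB_partial_sum a A t0 N t i j)).
  apply/cvgrPdist_lt => e e0; apply: filterS (Phi_unif e0) => N; exact.
apply: (cvg_unique _ S1) => //.
apply/cvgrPdist_le => e e0.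
(* d is chosen so that the bound K * (n M d) on the error is at most e *)
pose d := e / (K * (n%:R * M) + 1).
have d0 : 0 < d by rewrite divr_gt0// ltr_wpDl// mulr_ge0.
apply: filterS (Phi_unif d0) => N SN.
rewrite PB_partial_sum_rec// opprD addrACA subrr add0r.
have bP := bounded_measurable_mulmx bounded_measurable_Phi i j.
have bS := bounded_measurable_mulmx (bounded_measurable_PB_partial_sum N) i j.
have bNS := bounded_measurableM (bounded_measurable_cst t0 T (-1)) bS.
rewrite -mulN1r -(RL_integralZ a0 a1 (-1) bS tT) -(RL_integralD a0 a1 bP bNS tT).
have D s : t0 <= s <= T ->
    `|(A s *m Phi s) i j + -1 * (A s *m PB_partial_sum a A t0 N s) i j| <= n%:R * M * d.
  move=> sI; rewrite mulN1r !mxE -sumrB.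
  apply: (le_trans (ler_norm_sum _ _ _)).
  rewrite -[n%:R * M * d]mulrA -[n in n%:R](card_ord n) -sum1_card natr_sum mulr_suml.
  apply: ler_sum => k _; rewrite mul1r -mulrBr normrM ler_pM//; first exact: AM.
  exact/ltW/SN.
apply: (le_trans (RL_integral_bound a0 a1 (bounded_measurableD bP bNS) _ D tT)).
  by rewrite mulr_ge0// ltW.
rewrite -/K mulrA /d mulrCA ler_piMr ?(ltW e0)// ler_pdivrMr ?mul1r ?lerDl//.
by rewrite ltr_wpDl// mulr_ge0.
Qed.

Lemma bounded_measurable_Phi_mulmx (x0 : 'cV[R]_n) i : bm (fun s => (A s *m (Phi s *m x0)) i 0).
Proof.
apply: bounded_measurable_mulmx => k j; under [X in bm X]eq_fun do rewrite mxE.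
apply: bounded_measurable_sum => l.
by apply: bounded_measurableM; [exact: bounded_measurable_Phi|exact: bounded_measurable_cst].
Qed.

Lemma Phi_mulmx_volterra (x0 : 'cV[R]_n) t i : t0 <= t <= T ->
  (Phi t *m x0) i 0 = x0 i 0 + RL (fun s => (A s *m (Phi s *m x0)) i 0) t.
Proof.
move=> tI; have /andP[t0t tT] := tI.
have bP := bounded_measurable_mulmx bounded_measurable_Phi i.
rewrite mxE; under eq_bigr do rewrite Phi_volterra// mulrDl.
rewrite big_split/=; congr (_ + _).
  by rewrite -[x0 in RHS]mul1mx [RHS]mxE.
under eq_bigr do rewrite mulrC -(RL_integralZ a0 a1 _ (bP _) tT).
have bxP k : bm (fun s => x0 k 0 * (A s *m Phi s) i k).
  by apply: bounded_measurableM => //; exact: bounded_measurable_cst.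
rewrite -(RL_integral_sum a0 a1 _ bxP tT).
apply: eq_RL_integral => s _; rewrite mulmxA [RHS]mxE.
by apply: eq_bigr => k _; rewrite mulrC.
Qed.

End peano_baker.

Theorem theorem4 (R : realType) (n : nat) (a : R) (I : interval R) (t0 : R)
    (A : R -> 'M[R]_n) (x0 : 'cV[R]_n)
    (a_gt0 : 0 < a) (a_lt1 : a < 1)
    (t0I : t0 \in I)
    (A_cont : {within [set` I], continuous A})
    (PB_unif : {uniform [set t | t \in I /\ t0 <= t],
       PB_partial_sum a A t0 @ \oo --> (fun t => state_transition a A t t0)}) :
  let x := fun t => state_transition a A t t0 *m x0 in
  (forall t, (interior [set` I]) t -> t0 < t ->
     is_Caputo_cV a t0 x t (A t *m x t)) /\
  x t0 = x0.
Proof.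
pose Phi t := state_transition a A t t0; move=> x.
have sub T : T \in I -> forall s, t0 <= s <= T -> s \in I.
  by move=> TI s sI; exact: (interval_is_interval t0I TI).
have unif T : T \in I -> forall e : R, 0 < e -> \forall N \near \oo,
    forall s, t0 <= s <= T -> forall i j, `|Phi s i j - PB_partial_sum a A t0 N s i j| < e.
  move=> TI e e0.
  pose P : set (R -> 'M[R]_n) := [set h | forall s, s \in I /\ t0 <= s -> ball (Phi s) e (h s)].
  have : \forall N \near \oo, P (PB_partial_sum a A t0 N).
    apply: PB_unif; apply/uniform_nbhs.
    exists [set xy | ball xy.1 e xy.2]; split; last by [].
    exact: (entourage_ball _ (PosNum e0)).
  apply: filterS => N PN s /[dup] sI /andP[t0s _] i j.
  have [_ /(_ i j)] := PN s (conj (sub T TI s sI) t0s).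
  by [].
have bA T : T \in I -> forall i j, bounded_measurable t0 T (fun s => A s i j).
  move=> TI i j; apply: continuous_bounded_measurable.
  have sI : `[t0, T] `<=` [set` I].
    by move=> s; rewrite /= in_itv/=; exact: sub.
  have cA := continuous_subspaceW sI A_cont.
  move=> s; apply: (@continuous_comp _ _ _ _ (fun M : 'M[R]_n => M i j) _ (cA s)).
  exact: coord_continuous.
have xE T t i : T \in I -> t0 <= t <= T ->
    x t i 0 = x0 i 0 + RL_integral a t0 (fun s => (A s *m x s) i 0) t.
  by move=> TI; exact: (Phi_mulmx_volterra a_gt0 a_lt1 (bA T TI) (unif T TI)).
have xt0 : x t0 = x0.
  by apply/colP => i; rewrite (xE t0)// ?lexx// RL_integral_start addr0.
split=> // t tI t0t i.
(* a point of I beyond t, so that the segment [[t0, T]] is a neighbourhood of t *)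
have [T TI tT] : exists2 T, T \in I & t < T.
  case: tI => e /= e0 eI; exists (t + e / 2); last by rewrite ltrDl divr_gt0.
  apply: eI; rewrite /= opprD addNKr normrN gtr0_norm ?divr_gt0//.
  by rewrite ltr_pdivrMr// ltr_pMr// ltr1n.
have bAx k : bounded_measurable t0 T (fun s => (A s *m x s) k 0).
  exact: (bounded_measurable_Phi_mulmx a_gt0 a_lt1 (bA T TI) (unif T TI)).
have At : {for t, continuous A}.
  rewrite /prop_for /continuous_at (nbhs_subspace_interior tI); exact: A_cont.
(* x inherits the continuity of the fractional integral in its Volterra equation *)
have xt k : {for t, continuous (fun s => x s k 0)}.
  have RLc : {for t, continuous (fun s => x0 k 0 + RL_integral a t0 (fun s => (A s *m x s) k 0) s)}.
    by apply: cvgD; [exact: cvg_cst|exact: (RL_integral_continuous a_gt0 a_lt1 (bAx k) tT)].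
  rewrite /prop_for /continuous_at (xE T)// ?(ltW t0t) ?(ltW tT)//.
  apply: cvg_trans RLc; apply: near_eq_cvg; near=> s.
  rewrite -(xE T)//; apply/andP; split; apply: ltW; near: s; [exact: lt_nbhsr|exact: lt_nbhsl].
apply: (@is_Caputo_volterra _ a t0 T (fun s => x s i 0) (fun s => (A s *m x s) i 0)) => //.
- rewrite /prop_for /continuous_at mxE.
  under [X in X @ _ --> _]eq_fun do rewrite mxE.
  apply: cvg_big => [|k _]; first exact: add_continuous.
  apply: cvgM; last exact: xt.
  apply: (@continuous_comp _ _ _ _ (fun M : 'M[R]_n => M i k) _ At).
  exact: coord_continuous.
- by move=> s sI; rewrite xt0; exact: (xE T s i TI sI).
Unshelve. all: by end_near. Qed.
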